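(* There exist absolute constants $\epsilon_0>0$ and $K>0$ such that for every dimension $d\ge 1$, every finite set $S\subset\mathbb{R}^d$ (with the Euclidean metric), every $s\in S$ and every $0<\epsilon\le\epsilon_0$, there exists a $\left(1+\epsilon,\ \frac{5}{3\epsilon}+K\right)$-shallow-light tree for $S$ rooted at $s$.
   Context: For a finite point set $S$ in a normed space, consider the complete graph on $S$ in which each edge $xy$ has weight $w(x,y)=\|x-y\|$ (here the Euclidean distance). For a graph $H$ on $S$, $w(H)$ is the sum of its edge weights, and $\mathrm{dist}_H$ is the weighted shortest-path distance in $H$. Let $\mathrm{MST}(S)$ be a minimum-weight spanning tree of this complete graph. For $\alpha,\beta\ge 1$ and $s\in S$, an $(\alpha,\beta)$-shallow-light tree (SLT) for $S$ rooted at $s$ is a spanning tree $T$ of the complete graph on $S$ (no Steiner points) such that $\mathrm{dist}_T(s,t)\le\alpha\cdot w(s,t)$ for all $t\in S$ (root-stretch at most $\alpha$), and $w(T)\le\beta\cdot w(\mathrm{MST}(S))$ (lightness at most $\beta$). *)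

(* Defs.v *)
From HB Require Import structures.
From mathcomp Require Export all_boot all_order all_algebra finmap.
From mathcomp Require Export all_classical all_reals ereal.

Set Implicit Arguments.
Unset Strict Implicit.
Unset Printing Implicit Defensive.

Import Order.TTheory GRing.Theory Num.Theory.
Local Open Scope ring_scope.

Section WeightedGraphs.
Variables (R : realType) (V : finType) (w : V -> V -> R).
Implicit Types (e : rel V) (x y : V).

Definition simple_graph e : Prop := symmetric e /\ irreflexive e.

Definition connected_graph e : Prop := forall x y, connect e x y.

(* [cycle] also accepts back-and-forth walks [:: x; y] along one edge, so a
   graph cycle is a duplicate-free [cycle] on at least three vertices. *)
Definition acyclic_graph e : Prop :=
  forall c : seq V, uniq c -> cycle e c -> (size c < 3)%N.

(* A spanning tree of the complete graph on V. *)
Definition spanning_tree e : Prop :=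
  [/\ simple_graph e, connected_graph e & acyclic_graph e].

(* Every edge is counted in both orientations, hence the factor 1/2
   (for a symmetric w). *)
Definition graph_weight e : R :=
  (\sum_(x : V) \sum_(y : V | e x y) w x y) / 2.

(* Weight of the walk x :: p. *)
Definition walk_weight x (p : seq V) : R := \sum_(r <- pairmap w x p) r.

(* The infimum is +oo when no path of e joins x to y. *)
Definition graph_dist e x y : \bar R :=
  ereal_inf [set ((walk_weight x p)%:E)%E | p in
    [set p : seq V | path e x p /\ last x p = y]]%classic.

Definition min_spanning_tree e : Prop :=
  spanning_tree e /\
  forall e', spanning_tree e' -> graph_weight e <= graph_weight e'.

Definition shallow_light_tree (alpha beta : R) (s : V) e : Prop :=
  [/\ 1 <= alpha, 1 <= beta, spanning_tree e,
      forall t : V, (graph_dist e s t <= (alpha * w s t)%:E)%E &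
      exists2 m, min_spanning_tree m &
        graph_weight e <= beta * graph_weight m].

End WeightedGraphs.

(* The norm that the library puts on 'rV[R]_d is the sup norm. *)
Definition euclidean_dist (R : realType) (d : nat) (x y : 'rV[R]_d) : R :=
  Num.sqrt (\sum_(i < d) (x 0 i - y 0 i) ^+ 2).

(* Main.v *)
(** Root a minimum spanning tree M at s and write D v for the distance of v to s.
    Cut M into clusters of depth O(k eps D) with k = 1/5000: the cluster roots
    satisfy k eps (sum of D) <= w(M), so each may receive an extra edge of length
    O(eps D) at a total cost O(w(M)).  Among the cluster roots choose greedily, by
    increasing D, a net B such that any two b, b' in B are more than
    0.999 eps max(D b, D b') apart; join every net point to s and every other
    cluster root to a net point at distance at most 0.999 eps D.  The result has
    root-stretch 1 + eps, and it remains to show that eps (sum of D over B) is at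
    most (5/3) w(M).

    With r = eps D, nearly constant at the relevant scale, this asks that a
    Euclidean tree through points pairwise at distance about r have weight at
    least 3/5 of r per point.  Process the tree from the leaves, keeping at each
    vertex a residual (A, W) of at most three net points and the weight W of the
    subtree joining them, and discard it as soon as W pays 3/5 of the radii in A.
    An unpaid residual is short, so the sum Q of the squared distances from A to
    the vertex is small.  For two residuals A, A' meeting at c, with k and l
    points, first moments P, P' and second moments Q, Q',
      sum of |a - a'|^2 over A x A' = l Q + k Q' - 2 P.P',
    while the left side is about k l r^2 at least.  This rules out all unpaid
    meetings except 1 + 1 and 1 + 2. *)

Require Import Defs.
From mathcomp Require Import fintype finset ring lra.

Set Implicit Arguments.
Unset Strict Implicit.
Unset Printing Implicit Defensive.

Import Order.TTheory GRing.Theory Num.Theory.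
Local Open Scope ring_scope.

(** * Sums over finite sets *)

Lemma sum_setU (R : realType) (V : finType) (A B : {set V}) (F : V -> R) :
  [disjoint A & B] ->
  \sum_(i in A :|: B) F i = \sum_(i in A) F i + \sum_(i in B) F i.
Proof. by move=> dAB; rewrite -bigU //; apply: eq_bigl => i; rewrite !inE. Qed.

Lemma card_mul_le_sum (R : realType) (V : finType) (A : {set V}) (F : V -> R) m :
  (forall i, i \in A -> m <= F i) -> #|A|%:R * m <= \sum_(i in A) F i.
Proof.
move=> h; apply: (@le_trans _ _ (\sum_(i in A) m)); last exact: ler_sum.
by rewrite sumr_const mulr_natl.
Qed.

Lemma sum_le_card_mul (R : realType) (V : finType) (A : {set V}) (F : V -> R) m :
  (forall i, i \in A -> F i <= m) -> \sum_(i in A) F i <= #|A|%:R * m.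
Proof.
move=> h; apply: (@le_trans _ _ (\sum_(i in A) m)); first exact: ler_sum.
by rewrite sumr_const mulr_natl.
Qed.

(** * Inner product, norm, and first and second moments of a point set *)

Section Euclid.
Variables (R : realType) (d : nat).
Implicit Types u v w : 'rV[R]_d.

Definition dot u v : R := \sum_(i < d) u 0 i * v 0 i.
Definition nrm u : R := Num.sqrt (dot u u).

Lemma dotC u v : dot u v = dot v u.
Proof. by apply: eq_bigr => i _; rewrite mulrC. Qed.

Lemma dotDl u v w : dot (u + v) w = dot u w + dot v w.
Proof. by rewrite -big_split; apply: eq_bigr => i _; rewrite !mxE mulrDl. Qed.

Lemma dotZl a u w : dot (a *: u) w = a * dot u w.
Proof. by rewrite mulr_sumr; apply: eq_bigr => i _; rewrite !mxE mulrA. Qed.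

Lemma dotDr u v w : dot w (u + v) = dot w u + dot w v.
Proof. by rewrite dotC dotDl !(dotC w). Qed.

Lemma dotZr a u w : dot w (a *: u) = a * dot w u.
Proof. by rewrite dotC dotZl dotC. Qed.

Lemma dotNl u w : dot (- u) w = - dot u w.
Proof. by rewrite -scaleN1r dotZl mulN1r. Qed.

Lemma dotNr u w : dot w (- u) = - dot w u.
Proof. by rewrite dotC dotNl dotC. Qed.

Lemma dot_suml (I : finType) (A : {set I}) (F : I -> 'rV[R]_d) w :
  dot (\sum_(i in A) F i) w = \sum_(i in A) dot (F i) w.
Proof.
apply: (big_morph (fun u => dot u w)) => [u v|]; first exact: dotDl.
by rewrite -(scale0r 0) dotZl mul0r.
Qed.

Lemma dot_sumr (I : finType) (A : {set I}) (F : I -> 'rV[R]_d) w :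
  dot w (\sum_(i in A) F i) = \sum_(i in A) dot w (F i).
Proof. by rewrite dotC dot_suml; apply: eq_bigr => i _; rewrite dotC. Qed.

Lemma dot_ge0 u : 0 <= dot u u.
Proof. by apply: sumr_ge0 => i _; rewrite -expr2 sqr_ge0. Qed.

Lemma dot_eq0 u : dot u u = 0 -> u = 0.
Proof.
move=> /eqP; rewrite psumr_eq0 => [|i _]; last by rewrite -expr2 sqr_ge0.
move=> /allP h; apply/matrixP => i j; rewrite ord1 mxE; apply/eqP.
by have := h j (mem_index_enum j); rewrite mulf_eq0 orbb.
Qed.

Lemma nrm_ge0 u : 0 <= nrm u.
Proof. exact: sqrtr_ge0. Qed.

Lemma nrm_sqr u : nrm u ^+ 2 = dot u u.
Proof. by rewrite sqr_sqrtr // dot_ge0. Qed.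

Lemma nrm_le u a : 0 <= a -> (nrm u <= a) = (dot u u <= a ^+ 2).
Proof. by move=> a0; rewrite -nrm_sqr ler_pXn2r // ?nnegrE ?nrm_ge0. Qed.

Lemma nrm0P u : nrm u = 0 -> u = 0.
Proof. by move=> u0; apply: dot_eq0; rewrite -nrm_sqr u0 expr0n. Qed.

Lemma cauchy_schwarz u v : dot u v <= nrm u * nrm v.
Proof.
case: (eqVneq (nrm v) 0) => [/nrm0P -> | v0].
  by rewrite -(scale0r 0) dotZr mul0r mulr_ge0 ?nrm_ge0.
have vp : 0 < nrm v by rewrite lt_def v0 nrm_ge0.
case: (eqVneq (nrm u) 0) => [/nrm0P -> | u0].
  by rewrite -(scale0r 0) dotZl mul0r mulr_ge0 ?nrm_ge0.
have up : 0 < nrm u by rewrite lt_def u0 nrm_ge0.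
have := dot_ge0 (nrm v *: u - nrm u *: v).
rewrite !(dotDl, dotDr, dotNl, dotNr, dotZl, dotZr) (dotC v u) -!nrm_sqr => h.
rewrite -(ler_pM2l (mulr_gt0 up vp)).
nra.
Qed.

Lemma nrmN u : nrm (- u) = nrm u.
Proof. by rewrite /nrm dotNl dotNr opprK. Qed.

Lemma nrmB u v : nrm (u - v) = nrm (v - u).
Proof. by rewrite -nrmN opprB. Qed.

Lemma nrm_triangle v u w : nrm (u - w) <= nrm (u - v) + nrm (v - w).
Proof.
rewrite nrm_le ?addr_ge0 ?nrm_ge0 //.
have -> : u - w = (u - v) + (v - w) by rewrite addrA subrK.
move: (u - v) (v - w) => a b.
rewrite !dotDl !dotDr (dotC b a) -!nrm_sqr.
by have := cauchy_schwarz a b; nra.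
Qed.

Lemma euclidean_distE u v : euclidean_dist u v = nrm (u - v).
Proof.
by rewrite /euclidean_dist /nrm; congr Num.sqrt; apply: eq_bigr => i _; rewrite !mxE expr2.
Qed.

Lemma dot_sub_ge u v : - (2 * dot u v) <= dot u u + dot v v.
Proof.
have := dot_ge0 (u + v); rewrite !dotDl !dotDr (dotC v u); lra.
Qed.

Variables (V : finType) (pt : V -> 'rV[R]_d).
Implicit Types (A B : {set V}) (b : V) (c z : 'rV[R]_d).

Definition moment1 c (A : {set V}) := \sum_(b in A) (pt b - c).
Definition moment2 c (A : {set V}) := \sum_(b in A) dot (pt b - c) (pt b - c).

(** Expand each squared distance about [c]. With [B] equal to [A] this bounds the first moment of a
    separated set; with [A] and [B] disjoint it limits which residuals can meet at [c]. *)
Lemma sum_cross_dist c A B :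
  \sum_(a in A) \sum_(b in B) dot (pt a - pt b) (pt a - pt b) =
  #|B|%:R * moment2 c A + #|A|%:R * moment2 c B
    - 2 * dot (moment1 c A) (moment1 c B).
Proof.
have E a b : dot (pt a - pt b) (pt a - pt b) =
    dot (pt a - c) (pt a - c) + dot (pt b - c) (pt b - c)
    - 2 * dot (pt a - c) (pt b - c).
  have -> : pt a - pt b = (pt a - c) - (pt b - c) by rewrite opprB addrA subrK.
  move: (pt a - c) (pt b - c) => x y.
  by rewrite !(dotDl, dotDr, dotNl, dotNr) (dotC y x); ring.
under eq_bigr => a _.
  under eq_bigr do rewrite E.
  rewrite sumrB big_split /= sumr_const -mulr_sumr -dot_sumr.
  over.
rewrite sumrB big_split /= sumr_const -mulr_sumr -dot_suml.
by rewrite sumrMnl !mulr_natl.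
Qed.

(** The parallel axis identity: it measures how a second moment changes when a residual is carried
    from [c] to [z]. *)
Lemma moment2_shift c z A :
  moment2 z A = moment2 c A - 2 * dot (moment1 c A) (z - c)
    + #|A|%:R * dot (z - c) (z - c).
Proof.
rewrite /moment1 dot_suml mulr_sumr -sumrB mulr_natl -sumr_const -big_split /=.
apply: eq_bigr => b _.
have -> : pt b - z = (pt b - c) - (z - c) by rewrite opprB addrA subrK.
move: (pt b - c) (z - c) => x y.
by rewrite !(dotDl, dotDr, dotNl, dotNr) (dotC y x); ring.
Qed.

Lemma moment2U c A B : [disjoint A & B] ->
  moment2 c (A :|: B) = moment2 c A + moment2 c B.
Proof. exact: sum_setU. Qed.

Lemma le_moment2 c A b : b \in A -> nrm (pt b - c) ^+ 2 <= moment2 c A.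
Proof.
move=> bA; rewrite nrm_sqr /moment2 (bigD1 b) //= lerDl.
by apply: sumr_ge0 => i _; apply: dot_ge0.
Qed.

End Euclid.

(** * Real inequalities for moving and merging residuals *)

Section PackingArithmetic.
Variable R : realFieldType.

(* Moving a residual away from its meeting point u by x increases its second
   moment from Qu to at most Qu + 2 p x + k x^2, where p is the norm of the first
   moment.  The pairwise distances bound p from above in terms of Qu, and
   [2 p x mu <= x (2 p^2 + mu^2 / 2)] makes the increase absorbable. *)
Lemma drift_bound2 (mu a x W Qu Qc p : R) :
  0 < mu -> 0 <= a -> 0 <= x -> 0 <= p -> a + x <= W -> W < 6 / 5 * mu ->
  Qu <= mu * a - 239 / 500 * mu ^+ 2 ->
  p ^+ 2 <= 2 * Qu - 497 / 500 * mu ^+ 2 ->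
  Qc <= Qu + 2 * p * x + 2 * x ^+ 2 ->
  Qc <= mu * W - 229 / 500 * mu ^+ 2.
Proof.
move=> mu0 a0 x0 p0 aW Wmu hQ hp hc.
rewrite -(ler_pM2l mu0).
have h1 : 0 <= x * (2 * p - mu) ^+ 2 by rewrite mulr_ge0 ?sqr_ge0.
have h2 : x * p ^+ 2 <= x * (2 * (mu * a - 239 / 500 * mu ^+ 2) - 497 / 500 * mu ^+ 2).
  by apply: ler_wpM2l => //; clear -hQ hp; lra.
have h3 : x * mu * (a + x) <= x * mu * (6 / 5 * mu).
  apply: ler_wpM2l; first by rewrite mulr_ge0 // ltW.
  by clear -aW Wmu; lra.
(* What remains after [h1], [h2] and [h3] is a concave quadratic in [x], maximal at [mu / 10]; its
   maximum [mu ^+ 3 / 50] is exactly the loss from 239/500 to 229/500. *)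
have h4 : 0 <= mu * (x - 1 / 10 * mu) ^+ 2 by rewrite mulr_ge0 ?sqr_ge0 // ltW.
have h5 : mu * Qc <= mu * (mu * a - 239 / 500 * mu ^+ 2 + 2 * p * x + 2 * x ^+ 2).
  by rewrite ler_pM2l //; clear -hQ hc; lra.
have h6 : mu * (mu * (a + x)) <= mu * (mu * W) by rewrite !ler_pM2l.
have h7 : 0 <= x * mu ^+ 2 by rewrite mulr_ge0 // sqr_ge0.
have h8 : 0 <= mu ^+ 3 by rewrite exprn_ge0 // ltW.
by clear -h1 h2 h3 h4 h5 h6 h7 h8; lra.
Qed.

Lemma drift_bound3 (mu a x W Qu Qc p : R) :
  0 < mu -> 0 <= a -> 0 <= x -> 0 <= p -> a + x <= W -> W < 9 / 5 * mu ->
  Qu <= mu * a - 139 / 200 * mu ^+ 2 ->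
  p ^+ 2 <= 3 * Qu - 3 * (497 / 500) * mu ^+ 2 ->
  Qc <= Qu + 2 * p * x + 3 * x ^+ 2 ->
  Qc <= mu * W - 69 / 100 * mu ^+ 2.
Proof.
move=> mu0 a0 x0 p0 aW Wmu hQ hp hc.
rewrite -(ler_pM2l mu0).
have h1 : 0 <= x * (2 * p - mu) ^+ 2 by rewrite mulr_ge0 ?sqr_ge0.
have h2 : x * p ^+ 2 <= x * (3 * (mu * a - 139 / 200 * mu ^+ 2) - 3 * (497 / 500) * mu ^+ 2).
  by apply: ler_wpM2l => //; clear -hQ hp; lra.
have h3 : x * mu * (a + x) <= x * mu * (9 / 5 * mu).
  apply: ler_wpM2l; first by rewrite mulr_ge0 // ltW.
  by clear -aW Wmu; lra.
(* Here the remaining quadratic peaks near [3 / 100 * mu], and the allowed loss of 1/200 leaves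
   slack. *)
have h4 : 0 <= mu * (x - 3 / 100 * mu) ^+ 2 by rewrite mulr_ge0 ?sqr_ge0 // ltW.
have h5 : mu * Qc <= mu * (mu * a - 139 / 200 * mu ^+ 2 + 2 * p * x + 3 * x ^+ 2).
  by rewrite ler_pM2l //; clear -hQ hc; lra.
have h6 : mu * (mu * (a + x)) <= mu * (mu * W) by rewrite !ler_pM2l.
have h7 : 0 <= x * mu ^+ 2 by rewrite mulr_ge0 // sqr_ge0.
have h8 : 0 <= mu ^+ 3 by rewrite exprn_ge0 // ltW.
by clear -h1 h2 h3 h4 h5 h6 h7 h8; lra.
Qed.

Lemma ge_sqrt_bound (c x : R) : 0 <= x -> c ^+ 2 <= x ^+ 2 -> c <= x.
Proof.
move=> x0; have [c0|/ltW c0 _] := leP 0 c; last exact: le_trans c0 x0.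
by rewrite ler_pXn2r ?nnegrE.
Qed.

(** For two single points, separation forces [W + W' >= 249 / 250 * mu]. Each weight is below
    [3 / 5 * mu], so each is at least [99 / 250 * mu], and on that interval the convex function
    [w ^+ 2] lies below its chord. *)
Lemma merge_bound11 (mu W W' Q Q' x p p' : R) :
  0 < mu -> 0 <= W -> W < 3 / 5 * mu -> 0 <= W' -> W' < 3 / 5 * mu ->
  Q <= W ^+ 2 -> Q' <= W' ^+ 2 -> 0 <= p -> 0 <= p' ->
  p ^+ 2 <= Q -> p' ^+ 2 <= Q' -> - x <= p * p' ->
  497 / 500 * mu ^+ 2 <= Q + Q' - 2 * x ->
  Q + Q' <= mu * (W + W') - 239 / 500 * mu ^+ 2.
Proof.
move=> mu0 W0 hW W'0 hW' hQ hQ' p0 p'0 hp hp' hx X.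
have pW : p <= W by apply: (ge_sqrt_bound W0); exact: le_trans hp hQ.
have pW' : p' <= W' by apply: (ge_sqrt_bound W'0); exact: le_trans hp' hQ'.
have pp : p * p' <= W * W' by rewrite ler_pM.
have S : 249 / 250 * mu <= W + W'.
  apply: ge_sqrt_bound; first exact: addr_ge0.
  by have := sqr_ge0 mu; clear -X hx hQ hQ' pp; lra.
have H w : 99 / 250 * mu <= w -> w < 3 / 5 * mu ->
    w ^+ 2 <= mu * w - 239 / 1000 * mu ^+ 2.
  move=> h1 h2.
  have : 0 <= (w - 99 / 250 * mu) * (3 / 5 * mu - w).
    by apply: mulr_ge0; [clear -h1|clear -h2]; lra.
  have : 0 <= mu * (w - 99 / 250 * mu).
    by apply: mulr_ge0; [exact: ltW | clear -h1; lra].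
  have : 0 <= mu * (3 / 5 * mu - w).
    by apply: mulr_ge0; [exact: ltW | clear -h2; lra].
  by clear; lra.
have H1 := H W _ hW; have H2 := H W' _ hW'.
have {}H1 : W ^+ 2 <= mu * W - 239 / 1000 * mu ^+ 2.
  by apply: H1; clear -S hW'; lra.
have {}H2 : W' ^+ 2 <= mu * W' - 239 / 1000 * mu ^+ 2.
  by apply: H2; clear -S hW; lra.
by clear -H1 H2 hQ hQ'; lra.
Qed.

(** A pair of scale [m] meets a single point; [p] and [p'] are squared norms here. As [Q] is at most
    [371 / 500 * m ^+ 2], separation keeps [Q'] large and forces [w >= 2 / 5 * mu]; the chord of
    [w ^+ 2] over [[2/5 mu, 3/5 mu]] then gives the bound. *)
Lemma merge_bound21 (mu m W w Q Q' x p p' : R) :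
  0 < mu -> m <= mu -> 499 / 500 * mu <= m ->
  0 <= W -> W < 6 / 5 * m -> 0 <= w -> w < 3 / 5 * mu ->
  Q <= m * W - 229 / 500 * m ^+ 2 -> Q' <= w ^+ 2 ->
  p <= 2 * Q - 497 / 500 * m ^+ 2 -> p' <= Q' -> - (2 * x) <= p + p' ->
  497 / 250 * mu ^+ 2 <= Q + 2 * Q' - 2 * x ->
  Q + Q' <= mu * (W + w) - 139 / 200 * mu ^+ 2.
Proof.
move=> mu0 m1 m2 W0 hW w0 hw hQ hQ' hp hp' hx X.
have m0 : 0 <= m by clear -mu0 m2; lra.
have mm : m ^+ 2 <= mu ^+ 2 by rewrite lerXn2r ?nnegrE // ltW.
have mm' : 249 / 250 * mu ^+ 2 <= m ^+ 2.
  have h : (499 / 500 * mu) ^+ 2 <= m ^+ 2.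
    have c0 : 0 <= 499 / 500 * mu by clear -mu0; lra.
    by rewrite !expr2; apply: (ler_pM c0 c0 m2 m2).
  by have := sqr_ge0 mu; clear -h; lra.
have mW : m * W <= 6 / 5 * m ^+ 2.
  by have := ler_wpM2l m0 (ltW hW); clear; lra.
have mW' : m * W <= mu * W by rewrite ler_wpM2r.
have h : 2 / 5 * mu <= w.
  apply: ge_sqrt_bound => //.
  by have := sqr_ge0 mu; clear -mm mm' mW hQ hQ' hp hp' hx X; lra.
have : w ^+ 2 <= mu * w - 6 / 25 * mu ^+ 2.
  have : 0 <= (w - 2 / 5 * mu) * (3 / 5 * mu - w).
    by apply: mulr_ge0; [clear -h|clear -hw]; lra.
  have : 0 <= mu * (w - 2 / 5 * mu).
    by apply: mulr_ge0; [exact: ltW | clear -h; lra].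
  have : 0 <= mu * (3 / 5 * mu - w).
    by apply: mulr_ge0; [exact: ltW | clear -hw; lra].
  by clear; lra.
by have := sqr_ge0 mu; clear -mW' mm' hQ hQ'; lra.
Qed.

(* The second moment of an unpaid residual of k points, of radii about mu, at the
   point where its last two parts met, the tree there having weight a; local_cap
   is the resulting bound at any later point, for total weight W.  Ideally
   [2/5 mu <= W < 3/5 mu] for a single point, hence [W^2 <= mu W - 6/25 mu^2];
   the constants lose a little more at each merge and move. *)
Definition moment_cap (k : nat) mu a : R :=
  match k with
  | 1 => 0
  | 2 => mu * a - 239 / 500 * mu ^+ 2
  | _ => mu * a - 139 / 200 * mu ^+ 2
  end.

Definition local_cap (k : nat) mu W : R :=
  match k with
  | 1 => W ^+ 2
  | 2 => mu * W - 229 / 500 * mu ^+ 2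
  | _ => mu * W - 69 / 100 * mu ^+ 2
  end.

(* Bounds for Q and |P|^2, in units of mu^2, when W < 3/5 k mu. *)
Definition moment_sup (k : nat) : R :=
  match k with 1 => 9 / 25 | 2 => 371 / 500 | _ => 111 / 100 end.

Definition tilt_sup (k : nat) : R :=
  match k with 1 => 9 / 25 | 2 => 49 / 100 | _ => 87 / 250 end.

(** [x] stands for the inner product of the two first moments, [p] and [p'] for their norms. The
    pair in a 1 + 2 meeting may carry either the larger scale [mu] or the smaller scale [m]. *)
Lemma merge_bound (k l : nat) (mu m W W' Q Q' x p p' : R) :
  0 < m -> m <= mu -> 499 / 500 * mu <= m ->
  (0 < k <= 3)%N -> (0 < l <= 3)%N -> 0 <= W -> 0 <= W' ->
  W < 3 / 5 * k%:R * mu -> W' < 3 / 5 * l%:R * m ->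
  Q <= local_cap k mu W -> Q' <= local_cap l m W' ->
  Q <= moment_sup k * mu ^+ 2 -> Q' <= moment_sup l * m ^+ 2 ->
  p ^+ 2 <= tilt_sup k * mu ^+ 2 -> p' ^+ 2 <= tilt_sup l * m ^+ 2 ->
  p ^+ 2 <= k%:R * Q - k%:R * (k%:R - 1) / 2 * (497 / 500) * mu ^+ 2 ->
  p' ^+ 2 <= l%:R * Q' - l%:R * (l%:R - 1) / 2 * (497 / 500) * m ^+ 2 ->
  0 <= p -> 0 <= p' -> - (2 * x) <= p ^+ 2 + p' ^+ 2 -> - x <= p * p' ->
  k%:R * l%:R * (497 / 500 * mu ^+ 2) <= l%:R * Q + k%:R * Q' - 2 * x ->
  (k + l <= 3)%N /\ Q + Q' <= moment_cap (k + l) mu (W + W').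
Proof.
move=> m0 le_mu ge_mu hk hl W0 W'0 hW hW' hQ hQ' m1 m2 t1 t2 p1 p2 P0 P0' D CS X.
have mu0 := lt_le_trans m0 le_mu.
have mu2p : 0 < mu ^+ 2 by rewrite exprn_gt0.
have le_mu2 : m ^+ 2 <= mu ^+ 2 by rewrite lerXn2r ?nnegrE // ltW.
case: k hk hW hQ m1 t1 p1 X => [|[|[|[|k]]]] // _ hW /= hQ m1 t1 p1 X;
  case: l hl hW' hQ' m2 t2 p2 X => [|[|[|[|l]]]] // _ hW' /= hQ' m2 t2 p2 X;
  (* When [k + l > 3], the suprema of the moments contradict [X]. The tightest case is 2 + 2, where
     the right side is at most 3.948 and the left side is 3.976, in units of [mu ^+ 2]. *)
  try (by clear -mu2p le_mu2 m1 t1 m2 t2 D X; exfalso; lra); split=> //.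
- have q1 : p ^+ 2 <= Q by clear -p1; lra.
  have q2 : p' ^+ 2 <= Q' by clear -p2; lra.
  have w1 : W < 3 / 5 * mu by clear -hW; lra.
  have w2 : W' < 3 / 5 * mu by clear -hW' le_mu; lra.
  have xx : 497 / 500 * mu ^+ 2 <= Q + Q' - 2 * x by clear -X; lra.
  exact: (merge_bound11 mu0 W0 w1 W'0 w2 hQ hQ' P0 P0' q1 q2 CS xx).
- have q1 : p ^+ 2 <= Q by clear -p1; lra.
  have q2 : p' ^+ 2 <= 2 * Q' - 497 / 500 * m ^+ 2 by clear -p2; lra.
  have w1 : W < 3 / 5 * mu by clear -hW; lra.
  have w2 : W' < 6 / 5 * m by clear -hW'; lra.
  have xx : 497 / 250 * mu ^+ 2 <= Q' + 2 * Q - 2 * x by clear -X; lra.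
  rewrite addrC in D; rewrite addrC [W + _]addrC.
  exact: (merge_bound21 mu0 le_mu ge_mu W'0 w2 W0 w1 hQ' hQ q2 q1 D xx).
- have q1 : p ^+ 2 <= 2 * Q - 497 / 500 * mu ^+ 2 by clear -p1; lra.
  have q2 : p' ^+ 2 <= Q' by clear -p2; lra.
  have w1 : W < 6 / 5 * mu by clear -hW; lra.
  have w2 : W' < 3 / 5 * mu by clear -hW' le_mu; lra.
  have xx : 497 / 250 * mu ^+ 2 <= Q + 2 * Q' - 2 * x by clear -X; lra.
  have mm : 499 / 500 * mu <= mu by clear -mu0; lra.
  exact: (merge_bound21 mu0 (lexx mu) mm W0 w1 W'0 w2 hQ hQ' q1 q2 D xx).
Qed.

End PackingArithmetic.

(** * Residuals: drift along an edge, merging at a vertex, accounting *)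

Section Residuals.
Variables (R : realType) (d : nat) (V : finType) (pt : V -> 'rV[R]_d) (r : V -> R).
Implicit Types (A B : {set V}) (b : V) (c u : 'rV[R]_d) (a W mu : R).

(** For [r = eps * D] with [eps <= 1 / 1200], the first clause is the Lipschitz property of the
    distance to the root; it makes the radii of nearby points almost equal. *)
Definition spread A := forall b b', b \in A -> b' \in A -> b != b' ->
  r b - r b' <= nrm (pt b - pt b') / 1200 /\
  999 / 1000 * r b <= nrm (pt b - pt b').

Definition balanced mu A :=
  (forall b, b \in A -> 499 / 500 * mu <= r b <= mu) /\
  (exists2 b, b \in A & r b = mu).

(* The tree weight W at c splits into a weight a up to the last meeting point u
   and a path from u to c. *)
Definition residual c A W :=
  A = set0 /\ W = 0 \/
  exists u a mu,
    [/\ 0 <= a, 0 < mu & a + nrm (c - u) <= W] /\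
    [/\ W < 3 / 5 * \sum_(b in A) r b, (0 < #|A| <= 3)%N, balanced mu A &
        moment2 pt u A <= moment_cap #|A| mu a].

(** The constant 497/500 is just below the square of [999 / 1000 * (499 / 500)]. *)
Lemma spread_sqr A mu b b' : spread A -> 0 < mu ->
  (forall b, b \in A -> 499 / 500 * mu <= r b <= mu) ->
  b \in A -> b' \in A -> b != b' ->
  497 / 500 * mu ^+ 2 <= dot (pt b - pt b') (pt b - pt b').
Proof.
move=> sA mu0 hA bA b'A bb'; have [_ h] := sA b b' bA b'A bb'.
have /andP[h1 _] := hA b bA.
rewrite -nrm_sqr; nra.
Qed.

(** In [sum_cross_dist] for [A] against itself, the [k (k - 1)] ordered pairs of distinct points
    each contribute at least [497 / 500 * mu ^+ 2]. *)
Lemma moment1_le u A mu : spread A -> 0 < mu -> balanced mu A ->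
  dot (moment1 pt u A) (moment1 pt u A) <=
  #|A|%:R * moment2 pt u A
    - #|A|%:R * (#|A|%:R - 1) / 2 * (497 / 500) * mu ^+ 2.
Proof.
move=> sA mu0 [hA _].
have E := sum_cross_dist pt u A A.
suff : #|A|%:R * ((#|A|%:R - 1) * (497 / 500 * mu ^+ 2)) <=
  \sum_(a in A) \sum_(b in A) dot (pt a - pt b) (pt a - pt b).
  by rewrite E; lra.
apply: card_mul_le_sum => a aA.
rewrite (big_setD1 a) //= subrr -(scale0r 0) dotZl mul0r add0r.
have -> : #|A|%:R - 1 = #|A :\ a|%:R :> R.
  by rewrite (cardsD1 a A) aA add1n -natr1 addrK.
apply: card_mul_le_sum => b; rewrite !inE => /andP[ba bA].
by apply: spread_sqr sA mu0 hA aA bA _; rewrite eq_sym.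
Qed.

(** This eliminates the last meeting point [u]: by Cauchy-Schwarz the path from [u] to [c] adds a
    controlled amount to the second moment, and the drift bounds absorb it into [local_cap]. *)
Lemma residual_moment c A W : spread A -> residual c A W -> A != set0 ->
  exists mu, [/\ 0 < mu, balanced mu A, (0 < #|A| <= 3)%N, 0 <= W &
    W < 3 / 5 * #|A|%:R * mu /\ moment2 pt c A <= local_cap #|A| mu W].
Proof.
move=> sA [[-> _]|]; first by rewrite eqxx.
move=> [u [a [mu [[a0 mu0 aW] [hW hk hb hQ]]]]] _.
have Wmu : W < 3 / 5 * #|A|%:R * mu.
  apply: lt_le_trans hW _; rewrite -[leRHS]mulrA ler_pM2l; last by lra.
  apply: sum_le_card_mul => b bA.
  by have [/(_ b bA)/andP[]] := hb.
exists mu; split=> //; first by have := nrm_ge0 (c - u); lra.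
split=> //.
have hp := moment1_le u sA mu0 hb.
have hc : moment2 pt c A <= moment2 pt u A
    + 2 * nrm (moment1 pt u A) * nrm (c - u) + #|A|%:R * nrm (c - u) ^+ 2.
  rewrite (moment2_shift pt u c) nrm_sqr lerD2r lerD2l.
  have := cauchy_schwarz (- moment1 pt u A) (c - u).
  by rewrite nrmN dotNl; lra.
have x0 := nrm_ge0 (c - u); have p0 := nrm_ge0 (moment1 pt u A).
move: hp hc; rewrite -nrm_sqr.
case: #|A| hk Wmu hQ => [|[|[|[|k]]]] // _ Wmu /= hQ hp hc.
(* For one point [moment_cap] is 0, so [u] is that point and only the squared path length
   remains. *)
- have pz : nrm (moment1 pt u A) = 0.
    by apply/eqP; rewrite -sqrf_eq0 eq_le sqr_ge0 andbT; lra.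
  by move: hc; rewrite pz; nra.
- apply: (drift_bound2 mu0 a0 x0 p0 aW _ hQ _ hc); lra.
- apply: (drift_bound3 mu0 a0 x0 p0 aW _ hQ _ hc); lra.
Qed.

(** At [W = 3 / 5 * k * mu] the caps are 9/25, 371/500 and 111/100 in units of [mu ^+ 2], all below
    the square of 53/50. *)
Lemma near_of_moment c A W mu : 0 < mu -> (0 < #|A| <= 3)%N -> 0 <= W ->
  W < 3 / 5 * #|A|%:R * mu -> moment2 pt c A <= local_cap #|A| mu W ->
  forall b, b \in A -> nrm (pt b - c) <= 53 / 50 * mu.
Proof.
move=> mu0 hk W0 Wmu hQ b bA; rewrite nrm_le; last by lra.
rewrite -nrm_sqr; apply: le_trans (le_moment2 pt c bA) (le_trans hQ _).
by case: #|A| hk Wmu {hQ} => [|[|[|[|k]]]] //= _ Wmu; nra.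
Qed.

(** Used at the root, from which all net points are farther than this, to show that no residual
    survives there. *)
Lemma residual_near c A W : spread A -> residual c A W -> A != set0 ->
  exists2 b, b \in A & nrm (pt b - c) <= 53 / 50 * r b.
Proof.
move=> sA res An0; have [mu [mu0 hb hk W0 [Wmu hQ]]] := residual_moment sA res An0.
have [_ [b bA e]] := hb; exists b => //; rewrite e.
exact: near_of_moment mu0 hk W0 Wmu hQ b bA.
Qed.

(** The amount that the points of [A] are still owed once the weight [W] has been credited to
    them. *)
Definition deficit A W := 3 / 5 * \sum_(b in A) r b - W.

Lemma residual0 c : residual c set0 0.
Proof. by left. Qed.

Lemma deficit0 : deficit set0 0 = 0.
Proof. by rewrite /deficit big_set0 mulr0 subr0. Qed.

Lemma residual_set1 b : 0 < r b -> residual (pt b) [set b] 0.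
Proof.
move=> rb; right; exists (pt b), 0, (r b).
have sqrt0 : nrm (pt b - pt b) = 0 by rewrite subrr /nrm -(scale0r 0) dotZl mul0r sqrtr0.
split; first by split; rewrite ?sqrt0; lra.
split; rewrite ?cards1 ?big_set1 //=; first by lra.
  split; last by exists b; rewrite ?set11.
  by move=> b' /set1P ->; lra.
by rewrite /moment2 big_set1 -nrm_sqr sqrt0 expr0n.
Qed.

(** Either the longer path still leaves the residual unpaid and only [W] grows, or the residual is
    paid and is dropped, its deficit having become nonpositive. *)
Lemma residual_move c z A W : residual c A W ->
  exists A' W', [/\ residual z A' W', A' \subset A &
    deficit A W - nrm (z - c) <= deficit A' W'].
Proof.
move=> [[-> ->]|].
  exists set0, 0; split=> //; first exact: residual0.
  by rewrite deficit0; have := nrm_ge0 (z - c); lra.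
move=> [u [a [mu [[a0 mu0 aW] [hW hk hb hQ]]]]].
have [keep|cut] := ltP (W + nrm (z - c)) (3 / 5 * \sum_(b in A) r b).
  exists A, (W + nrm (z - c)); split=> //; last by rewrite /deficit; lra.
  right; exists u, a, mu; split=> //; split=> //.
  by have := nrm_triangle c z u; lra.
exists set0, 0; split; [exact: residual0 | exact: sub0set |].
by rewrite deficit0 /deficit; lra.
Qed.

Lemma residual_sup c A W mu : spread A -> 0 < mu -> balanced mu A ->
  (0 < #|A| <= 3)%N -> 0 <= W -> W < 3 / 5 * #|A|%:R * mu ->
  moment2 pt c A <= local_cap #|A| mu W ->
  moment2 pt c A <= moment_sup R #|A| * mu ^+ 2 /\
  dot (moment1 pt c A) (moment1 pt c A) <= tilt_sup R #|A| * mu ^+ 2.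
Proof.
move=> sA mu0 hb hk W0 hW hQ; have hp := moment1_le c sA mu0 hb.
suff hQ' : moment2 pt c A <= moment_sup R #|A| * mu ^+ 2.
  split=> //; apply: le_trans hp _; move: hQ'.
  by case: #|A| hk => [|[|[|[|k]]]] //= _; lra.
apply: le_trans hQ _.
by case: #|A| hk hW => [|[|[|[|k]]]] //= _ hW; nra.
Qed.

(** A point of [B] lies within [53 / 25 * mu] of the point of [A] of radius [mu], so the radii
    differ by at most [53 / 30000 * mu], which is below [mu / 500]. *)
Lemma union_balanced c A B mu mu' : spread (A :|: B) -> 0 < mu' -> mu' <= mu ->
  balanced mu A -> balanced mu' B ->
  (forall b, b \in A -> nrm (pt b - c) <= 53 / 50 * mu) ->
  (forall b, b \in B -> nrm (pt b - c) <= 53 / 50 * mu') ->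
  balanced mu (A :|: B).
Proof.
move=> sAB mu'0 le_mu [hA [b0 b0A e0]] [hB _] nA nB.
split; last by exists b0; rewrite // inE b0A.
move=> b; rewrite inE => /orP[/hA //|bB].
have /andP[_ h2] := hB b bB; rewrite (le_trans h2 le_mu) andbT.
have [->|bb0] := eqVneq b b0; first by have /andP[] := hA b0 b0A.
have b0AB : b0 \in A :|: B by rewrite inE b0A.
have bAB : b \in A :|: B by rewrite inE bB orbT.
have ne : b0 != b by rewrite eq_sym.
have [h _] := sAB b0 b b0AB bAB ne.
have := nrm_triangle c (pt b0) (pt b); rewrite (nrmB c).
by have := nA b0 b0A; have := nB b bB; rewrite e0 in h; lra.
Qed.

Lemma union_cross c A B mu : [disjoint A & B] -> spread (A :|: B) -> 0 < mu ->
  balanced mu (A :|: B) ->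
  #|A|%:R * #|B|%:R * (497 / 500 * mu ^+ 2) <=
  #|B|%:R * moment2 pt c A + #|A|%:R * moment2 pt c B
    - 2 * dot (moment1 pt c A) (moment1 pt c B).
Proof.
move=> dAB sAB mu0 [hAB _].
rewrite -sum_cross_dist -mulrA; apply: card_mul_le_sum => a aA.
apply: card_mul_le_sum => b bB.
apply: (spread_sqr sAB mu0 hAB); rewrite ?inE ?aA ?bB ?orbT //.
by apply: contraTneq aA => ->; rewrite (disjointFl dAB).
Qed.

Lemma spreadW A B : A \subset B -> spread B -> spread A.
Proof. by move=> /subsetP AB sB b b' /AB bB /AB b'B; apply: sB. Qed.

Lemma spreadU A B : spread (A :|: B) -> spread A /\ spread B.
Proof. by move=> sAB; split; apply: spreadW sAB; [exact: subsetUl | exact: subsetUr]. Qed.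

Lemma union_moment c A B W W' mu mu' :
  [disjoint A & B] -> spread (A :|: B) -> 0 < mu' -> mu' <= mu ->
  balanced mu A -> balanced mu' B ->
  (0 < #|A| <= 3)%N -> (0 < #|B| <= 3)%N -> 0 <= W -> 0 <= W' ->
  W < 3 / 5 * #|A|%:R * mu -> W' < 3 / 5 * #|B|%:R * mu' ->
  moment2 pt c A <= local_cap #|A| mu W ->
  moment2 pt c B <= local_cap #|B| mu' W' ->
  balanced mu (A :|: B) ->
  (#|A| + #|B| <= 3)%N /\
  moment2 pt c A + moment2 pt c B <= moment_cap (#|A| + #|B|) mu (W + W').
Proof.
move=> dAB sAB mu'0 le_mu bA bB kA kB W0 W'0 hW hW' hQ hQ' bAB.
have mu0 := lt_le_trans mu'0 le_mu.
have [sA sB] := spreadU sAB.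
have [m1 t1] := residual_sup sA mu0 bA kA W0 hW hQ.
have [m2 t2] := residual_sup sB mu'0 bB kB W'0 hW' hQ'.
have X := union_cross c dAB sAB mu0 bAB.
have D := dot_sub_ge (moment1 pt c A) (moment1 pt c B).
have ge_mu : 499 / 500 * mu <= mu'.
  have [_ [b bB' e]] := bB; have [/(_ b)] := bAB; rewrite inE bB' orbT e.
  by move=> /(_ isT)/andP[].
have p1 := moment1_le c sA mu0 bA; have p2 := moment1_le c sB mu'0 bB.
have CS : - dot (moment1 pt c A) (moment1 pt c B)
    <= nrm (moment1 pt c A) * nrm (moment1 pt c B).
  by rewrite -dotNl -[X in X * _]nrmN cauchy_schwarz.
rewrite -!nrm_sqr in t1 t2 D p1 p2.
exact: (merge_bound mu'0 le_mu ge_mu kA kB W0 W'0 hW hW' hQ hQ' m1 m2 t1 t2 p1 p2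
  (nrm_ge0 _) (nrm_ge0 _) D CS X).
Qed.

Lemma deficitU A B W W' : [disjoint A & B] ->
  deficit (A :|: B) (W + W') = deficit A W + deficit B W'.
Proof. by move=> dAB; rewrite /deficit sum_setU //; lra. Qed.

Lemma residual_merge c A B W W' : [disjoint A & B] -> spread (A :|: B) ->
  residual c A W -> residual c B W' ->
  exists C W'', [/\ residual c C W'', C \subset A :|: B &
    deficit A W + deficit B W' <= deficit C W''].
Proof.
have [-> _ _ [[_ ->]|] |An0] := eqVneq A set0.
- by move=> h; exists B, W'; rewrite set0U deficit0 add0r.
- move=> [u [a [mu [_ [_ + _ _]]]]]; by rewrite cards0.
have [-> _ _ h [[_ ->]|] |Bn0] := eqVneq B set0.
- by exists A, W; rewrite setU0 deficit0 addr0.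
- move=> [u [a [mu [_ [_ + _ _]]]]]; by rewrite cards0.
move=> dAB sAB resA resB.
have [cut|keep] := leP (3 / 5 * \sum_(b in A :|: B) r b) (W + W').
  exists set0, 0; split; [exact: residual0 | exact: sub0set |].
  by rewrite deficit0 -deficitU // /deficit subr_le0.
exists (A :|: B), (W + W'); split=> //; last by rewrite deficitU.
(* By symmetry, [A] may be taken to carry the larger scale. *)
wlog : A B W W' An0 Bn0 dAB sAB resA resB keep / exists mu mu',
    [/\ mu' <= mu, 0 < mu', balanced mu A, (0 < #|A| <= 3)%N & 0 <= W] /\
    [/\ W < 3 / 5 * #|A|%:R * mu /\ moment2 pt c A <= local_cap #|A| mu W,
        balanced mu' B, (0 < #|B| <= 3)%N, 0 <= W' &
        W' < 3 / 5 * #|B|%:R * mu' /\ moment2 pt c B <= local_cap #|B| mu' W'].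
  have [sA sB] := spreadU sAB.
  have [mu [mu0 hb hk W0 hW]] := residual_moment sA resA An0.
  have [mu' [mu'0 hb' hk' W'0 hW']] := residual_moment sB resB Bn0.
  have [le_mu|/ltW le_mu] := leP mu' mu.
    by move=> H; apply: H => //; exists mu, mu'.
  move=> H; rewrite setUC [W + _]addrC; apply: H => //.
  - by rewrite disjoint_sym.
  - by rewrite setUC.
  - by rewrite setUC [W' + _]addrC.
  - by exists mu', mu.
move=> [mu [mu' [[le_mu mu'0 bA kA W0] [[hW hQ] bB kB W'0 [hW' hQ']]]]].
have mu0 := lt_le_trans mu'0 le_mu.
have bAB := union_balanced sAB mu'0 le_mu bA bB
  (near_of_moment mu0 kA W0 hW hQ) (near_of_moment mu'0 kB W'0 hW' hQ').
have [kAB mAB] := union_moment dAB sAB mu'0 le_mu bA bB kA kB W0 W'0 hW hW' hQ hQ' bAB.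
have cAB : #|A :|: B| = (#|A| + #|B|)%N.
  by rewrite cardsU disjoint_setI0 // cards0 subn0.
(* The new meeting point is [c] itself, so all the weight lies before it and the path after it has
   length 0. *)
right; exists c, (W + W'), mu; split.
  by split=> //; [exact: addr_ge0 | rewrite subrr /nrm -(scale0r 0) dotZl mul0r sqrtr0 addr0].
split=> //; last by rewrite moment2U // cAB.
by rewrite cAB kAB andbT addn_gt0; case/andP: kA => ->.
Qed.

End Residuals.

(** * Rooted trees: leaf removal, packing bound, cluster decomposition *)

Lemma disjointP (V : finType) (A B : {set V}) :
  (forall x, x \in A -> x \in B -> False) -> [disjoint A & B].
Proof. by move=> h; apply/pred0P => x /=; apply/negP => /andP[/h]. Qed.

Section RootedTrees.
Variables (R : realType) (V : finType) (s : V) (par : V -> V) (rank : V -> R).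
Hypothesis rank_par : forall v, v != s -> rank (par v) < rank v.

Lemma par_neq v : v != s -> par v != v.
Proof. by move=> /rank_par; apply: contraTneq => ->; rewrite ltxx. Qed.

(** A vertex of maximal rank in [U] is no parent of a vertex of [U], so removing it keeps [U] closed
    under parents. *)
Lemma leaf_induction (P : {set V} -> Prop) :
  P [set: V] ->
  (forall (U : {set V}) v, v \in U -> v != s -> par v \in U -> P U -> P (U :\ v)) ->
  P [set s].
Proof.
move=> PT step.
suff H n (U : {set V}) : #|U| = n -> s \in U -> (forall u, u \in U -> u != s -> par u \in U) ->
    P U -> P [set s].
  by apply: H PT => // *; rewrite inE.
elim: n U => [|n IH] U cU sU clU PU; first by rewrite (cards0_eq cU) inE in sU.
have [e|ne] := eqVneq (U :\ s) set0.
  suff <- : U = [set s] by [].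
  by rewrite -(setD1K sU) e setU0.
have [v0 v0U] := set0Pn _ ne.
case: (@Order.TotalTheory.arg_maxP _ _ _ v0 (fun x => x \in U :\ s) rank v0U) => v.
rewrite !inE => /andP[vs vU] vmax.
apply: (IH (U :\ v)).
- by move: cU; rewrite (cardsD1 v) vU add1n => -[].
- by rewrite !inE eq_sym vs.
- move=> u; rewrite !inE => /andP[uv uU] us; rewrite clU // andbT.
  apply: contraTneq (rank_par us) => ->; rewrite -leNgt.
  by apply: vmax; rewrite !inE us.
- exact: step (clU v vU vs) PU.
Qed.

Variables (d : nat) (pt : V -> 'rV[R]_d).

Definition edge_len v := nrm (pt v - pt (par v)).

Lemma sum_setC_D1 (U : {set V}) v (F : V -> R) : v \in U ->
  \sum_(u in ~: (U :\ v)) F u = F v + \sum_(u in ~: U) F u.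
Proof.
by move=> vU; rewrite setCD setUC big_setU1 //= inE vU.
Qed.

(** Each removed edge pays for the deficit lost while moving along it. At the end the residual at
    [s] must be empty, since net points are too far from [s], so every radius has been paid. *)
Lemma packing_bound (r : V -> R) (B : {set V}) :
  s \notin B -> (forall b, b \in B -> 0 < r b) -> spread pt r B ->
  (forall b, b \in B -> 53 / 50 * r b < nrm (pt b - pt s)) ->
  3 / 5 * \sum_(b in B) r b <= \sum_(v in ~: [set s]) edge_len v.
Proof.
move=> sB rB spB farB.
(* U is what is left of the tree after removing leaves; l v and W v form the
   residual pushed down to v. *)
pose P (U : {set V}) := exists (l : V -> {set V}) (W : V -> R),
  [/\ forall v, v \in U -> residual pt r (pt v) (l v) (W v),
      forall v, v \in U -> l v \subset B :\: U,
      forall u v x, u \in U -> v \in U -> x \in l u -> x \in l v -> u = v &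
      3 / 5 * \sum_(b in B :\: U) r b <=
        \sum_(v in ~: U) edge_len v + \sum_(v in U) deficit r (l v) (W v)].
suff [l [W [hres hsub _ hle]]] : P [set s].
  have s_in : s \in [set s] by rewrite set11.
  have BE : B :\: [set s] = B by apply/setDidPl; rewrite disjoint_sym disjoints1.
  have lB : l s \subset B by rewrite -BE hsub.
  have l0 : l s = set0.
    apply/eqP/negPn/negP => ne.
    have spl := spreadW lB spB.
    have [b bl near] := residual_near spl (hres s s_in) ne.
    by have := lt_le_trans (farB b (subsetP lB b bl)) near; rewrite ltxx.
  have W0 : 0 <= W s.
    have [[_ ->] //|] := hres s s_in.
    by move=> [u [a [mu [_ [_ + _ _]]]]]; rewrite l0 cards0.
  move: hle; rewrite BE big_set1 /deficit l0 big_set0; lra.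
apply: leaf_induction.
  exists (fun=> set0), (fun=> 0); split.
  - by move=> v _; apply: residual0.
  - by move=> v _; apply: sub0set.
  - by move=> u v x _ _; rewrite inE.
  - rewrite setDT big_set0 mulr0; apply: addr_ge0; apply: sumr_ge0 => v _.
      exact: nrm_ge0.
    by rewrite deficit0.
move=> U v vU vs pU [l [W [hres hsub hdis hle]]].
set p := par v in pU *.
have pv : p != v := par_neq vs.
have lBU u x : u \in U -> x \in l u -> (x \in B) && (x \notin U).
  by move=> uU xl; have := subsetP (hsub u uU) x xl; rewrite inE andbC.
pose A0 := if v \in B then [set v] else set0.
have A0v x : x \in A0 -> x = v /\ v \in B.
  by rewrite /A0; case: ifP => vB; rewrite inE // => /eqP.
have res0 : residual pt r (pt v) A0 0.
  by rewrite /A0; case: ifP => vB; [apply/residual_set1/rB | apply: residual0].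
have spsub (A : {set V}) : {subset A <= B} -> spread pt r A.
  by move=> /subsetP AB; apply: spreadW AB spB.
(* Removing the leaf [v] takes three operations: merge the point [v], if it is in [B], with the
   residual at [v]; move the result to the parent [p]; merge it with the residual at [p]. *)
have [A1 [W1 [res1 sub1 def1]]] : exists C W'', [/\ residual pt r (pt v) C W'',
    C \subset A0 :|: l v & deficit r A0 0 + deficit r (l v) (W v) <= deficit r C W''].
  apply: residual_merge res0 (hres v vU).
    by apply: disjointP => x /A0v[-> _] /(lBU v _ vU); rewrite vU andbF.
  apply: spsub => x; rewrite inE => /orP[/A0v[-> //]|/(lBU v _ vU)/andP[]//].
have [A2 [W2 [res2 sub2 def2]]] := residual_move (pt p) res1.
have A2x x : x \in A2 -> (x = v /\ v \in B) \/ x \in l v.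
  move=> /(subsetP sub2)/(subsetP sub1); rewrite inE => /orP[/A0v|]; by [left|right].
have [A3 [W3 [res3 sub3 def3]]] : exists C W'', [/\ residual pt r (pt p) C W'',
    C \subset A2 :|: l p & deficit r A2 W2 + deficit r (l p) (W p) <= deficit r C W''].
  apply: residual_merge res2 (hres p pU).
    apply: disjointP => x /A2x[[-> _]|xv] xp.
      by have := lBU p v pU xp; rewrite vU andbF.
    by move: pv; rewrite (hdis _ _ _ vU pU xv xp) eqxx.
  apply: spsub => x; rewrite inE => /orP[/A2x[[-> //]|]|].
    by move=> /(lBU v _ vU)/andP[].
  by move=> /(lBU p _ pU)/andP[].
have A3x x : x \in A3 -> [\/ x = v /\ v \in B, x \in l v | x \in l p].
  move=> /(subsetP sub3); rewrite inE => /orP[/A2x[]|];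
    by [constructor 1|constructor 2|constructor 3].
exists (fun u => if u == p then A3 else l u), (fun u => if u == p then W3 else W u); split.
- move=> u; rewrite !inE => /andP[_ uU]; case: eqP => [->|_] //; exact: hres.
- move=> u; rewrite !inE => /andP[_ uU]; apply/subsetP => x.
  rewrite !inE negb_and negbK; case: eqP => _.
    by case/A3x => [[-> ->]|/(lBU v _ vU)/andP[-> ->]|/(lBU p _ pU)/andP[-> ->]];
      rewrite ?eqxx ?orbT.
  by move=> /(lBU u _ uU)/andP[-> ->]; rewrite orbT.
- have key u x : u \in U -> u != v -> u != p -> x \in A3 -> x \in l u -> False.
    move=> uU uv up /A3x[[-> _]|xv|xp] xu.
    + by have := lBU u v uU xu; rewrite vU andbF.
    + by move: uv; rewrite (hdis _ _ _ uU vU xu xv) eqxx.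
    + by move: up; rewrite (hdis _ _ _ uU pU xu xp) eqxx.
  move=> u u' x; rewrite !inE => /andP[uv uU] /andP[uv' uU'].
  have [->|up] := eqVneq u p; have [->|up'] := eqVneq u' p => //.
  + by move=> x3 xu; case: (key u' x).
  + by move=> xu x3; case: (key u x).
  + exact: hdis.
have pUv : p \in U :\ v by rewrite !inE pv.
rewrite (sum_setC_D1 _ vU) (big_setD1 p pUv) /= eqxx.
have -> : \sum_(u in U :\ v :\ p)
      deficit r (if u == p then A3 else l u) (if u == p then W3 else W u) =
    \sum_(u in U :\ v :\ p) deficit r (l u) (W u).
  by apply: eq_bigr => u; rewrite in_setD1 => /andP[/negbTE up _]; rewrite up.
move: hle; rewrite (big_setD1 v vU) /= (big_setD1 p pUv) /=.
set X := \sum_(i in _ :\ _) _; set Y := \sum_(i in ~: U) _.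
have -> : \sum_(b in B :\: (U :\ v)) r b = \sum_(b in A0) r b + \sum_(b in B :\: U) r b.
  rewrite -sum_setU; last first.
    by apply: disjointP => x /A0v[-> _]; rewrite inE vU.
  apply: eq_bigl => x; rewrite !inE negb_and negbK andb_orl.
  have -> : (x \in A0) = (x == v) && (x \in B).
    rewrite /A0; have [->|xv] := eqVneq x v; last first.
      by case: ifP; rewrite inE // (negbTE xv).
    by case: ifP; rewrite inE // eqxx.
  by [].
have len_e : edge_len v = nrm (pt p - pt v) by rewrite /edge_len nrmB.
move: def1; rewrite {1}/deficit len_e; move: def2 def3.
move: (deficit _ _ _) (deficit _ _ _) (deficit _ _ _) (deficit _ _ _) => *; lra.
Qed.

(* h v is the depth of the part of the cluster of v lying below v. *)
Lemma cluster_decomposition (D : V -> R) (k : R) : 0 < k -> k <= 1 / 2 ->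
  (forall v, 0 <= D v) ->
  (forall v, v != s -> D v <= D (par v) + edge_len v) ->
  exists (C : {set V}) (h : V -> R),
    [/\ s \notin C, forall v, 0 <= h v <= 2 * k * D v,
        forall v, v != s -> v \notin C -> edge_len v + h v <= h (par v) &
        k * \sum_(c in C) D c <= \sum_(v in ~: [set s]) edge_len v].
Proof.
move=> k0 k2 D0 lipD.
have e0 v : 0 <= edge_len v by apply: nrm_ge0.
pose P (U : {set V}) := exists (C : {set V}) (h : V -> R),
  [/\ C \subset ~: U, forall v, 0 <= h v <= 2 * k * D v,
      forall v, v \notin U -> v \notin C -> edge_len v + h v <= h (par v) &
      k * \sum_(c in C) D c + \sum_(v in U) h v <= \sum_(v in ~: U) edge_len v].
suff [C [h [sC hh hpar hle]]] : P [set s].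
  exists C, h; split=> //.
  - by apply/negP => /(subsetP sC); rewrite !inE eqxx.
  - by move=> v vs; apply: hpar; rewrite inE.
  - apply: le_trans hle; rewrite big_set1 lerDl.
    by case/andP: (hh s).
apply: leaf_induction.
  exists set0, (fun=> 0); split.
  - exact: sub0set.
  - by move=> v; rewrite lexx; apply: mulr_ge0 => //; apply: mulr_ge0 => //; exact: ltW.
  - by move=> v; rewrite inE.
  - by rewrite big_set0 mulr0 sumr_const mul0rn addr0; apply: sumr_ge0.
move=> U v vU vs pU [C [h [sC hh hpar hle]]].
set p := par v in pU.
have pv : p != v := par_neq vs.
have pUv : p \in U :\ v by rewrite !inE pv.
have vC : v \notin C by apply/negP => /(subsetP sC); rewrite inE vU.
(* The sum of [h] over [U] is a potential: a new cluster root [v] pays [k * D v] with its own edge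
   and the released [h v]. *)
have [cut|keep] := ltP (k * D v) (edge_len v + h v).
  exists (v |: C), h; split=> //.
  - apply/subsetP => x; rewrite !inE negb_and negbK => /orP[->//|/(subsetP sC)].
    by rewrite inE => ->; rewrite orbT.
  - move=> x; rewrite !inE negb_and negbK negb_or.
    by case: eqP => //= _; apply: hpar.
  - rewrite (sum_setC_D1 _ vU) big_setU1 //=.
    by move: hle; rewrite (big_setD1 v vU) /=; lra.
pose h' u := if u == p then Order.max (h p) (edge_len v + h v) else h u.
have h'p : h p <= h' p /\ edge_len v + h v <= h' p.
  by rewrite /h' eqxx !le_max !lexx orbT.
have h'ge u : h u <= h' u.
  by rewrite /h'; case: eqP => [->|//]; rewrite le_max lexx.
exists C, h'; split.
- apply/subsetP => x /(subsetP sC); rewrite !inE => /negbTE ->.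
  by rewrite andbF.
- move=> u; rewrite /h'; case: eqP => [->|//].
  have /andP[hp1 hp2] := hh p; have /andP[hv1 _] := hh v.
  apply/andP; split; first by rewrite le_max hp1.
  rewrite ge_max hp2 /=; apply: (le_trans keep).
  (* The kept edge is at most [k * D v <= D v / 2], so [D v <= 2 * D p]; this is the factor 2 in the
     bound on [h]. *)
  have e1 := lipD v vs; rewrite -/p in e1.
  have k0' := ltW k0.
  have e2 : k * D v <= 1 / 2 * D v by apply: ler_wpM2r.
  have e3 : k * D v <= k * (2 * D p).
    apply: ler_wpM2l => //; lra.
  lra.
- move=> u; rewrite !inE negb_and negbK.
  have [-> _ _|uv /= uU uC] := eqVneq u v.
    by case: h'p => _; rewrite {2}/h' eq_sym (negbTE pv).
  have -> : h' u = h u.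
    by rewrite /h'; case: eqP uU => // ->; rewrite pU.
  exact: le_trans (hpar u uU uC) (h'ge _).
- rewrite (sum_setC_D1 _ vU) (big_setD1 p pUv) /=.
  have -> : \sum_(u in U :\ v :\ p) h' u = \sum_(u in U :\ v :\ p) h u.
    by apply: eq_bigr => u; rewrite in_setD1 /h' => /andP[/negbTE -> _].
  have h'le : h' p <= h p + (edge_len v + h v).
    have /andP[hp1 _] := hh p; have /andP[hv1 _] := hh v; have := e0 v.
    by rewrite /h' eqxx ge_max; lra.
  by move: hle; rewrite (big_setD1 v vU) /= (big_setD1 p pUv) /=; lra.
Qed.

End RootedTrees.

(** * Greedy nets *)

(** Induct by removing a point of maximal [rho]: it is considered last, so any net point covering it
    has no larger [rho], and if none covers it, it is separated from the net at its own, larger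
    scale. *)
Lemma greedy_net (R : realType) (V : finType) (delta : V -> V -> R) (rho : V -> R)
    (C : {set V}) : (forall x y, delta x y = delta y x) ->
  exists B : {set V}, [/\ B \subset C,
    forall b b', b \in B -> b' \in B -> b != b' -> rho b < delta b b' &
    forall c, c \in C -> c \notin B ->
      exists2 b, b \in B & rho b <= rho c /\ delta b c <= rho c].
Proof.
move=> delta_sym.
elim: {C}_.+1 {-2}C (ltnSn #|C|) => // n IH C cC.
have [->|] := eqVneq C set0.
  by exists set0; split; rewrite ?sub0set // => x; rewrite inE.
move=> /set0Pn[c0 c0C].
case: (@Order.TotalTheory.arg_maxP _ _ _ c0 (fun x => x \in C) rho c0C) => c cinC cmax.
have [|B [BC sepB netB]] := IH (C :\ c).
  by move: cC; rewrite (cardsD1 c C) cinC add1n ltnS.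
have BC' x : x \in B -> x != c /\ x \in C.
  by move=> /(subsetP BC); rewrite !inE => /andP.
have [/exists_inP[b bB near]|/exists_inPn far] :=
    boolP [exists b in B, delta b c <= rho c].
  exists B; split=> //; first exact: subset_trans BC (subD1set _ _).
  move=> x xC xB; have [->|xc] := eqVneq x c.
    by exists b => //; split=> //; apply: cmax; case: (BC' b bB).
  by apply: netB => //; rewrite !inE xc.
have far' b : b \in B -> rho b < delta b c /\ rho c < delta b c.
  move=> bB; have := far b bB; rewrite -ltNge => lt; split=> //.
  by apply: le_lt_trans lt; apply: cmax; case: (BC' b bB).
exists (c |: B); split.
- by rewrite subUset sub1set cinC (subset_trans BC) // subD1set.
- move=> b b'; rewrite !inE => /orP[/eqP->|bB] /orP[/eqP->|b'B]; rewrite ?eqxx //.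
  + by move=> _; rewrite delta_sym; case: (far' b' b'B).
  + by move=> _; case: (far' b bB).
  + exact: sepB.
- move=> x xC; rewrite !inE negb_or => /andP[xc xB].
  have [|b bB hb] := netB x _ xB; first by rewrite !inE xc.
  by exists b => //; rewrite inE bB orbT.
Qed.

(** * Walks, shortest-path labels, and spanning trees from parent maps *)

Section Walks.
Variables (R : realType) (V : finType) (w : V -> V -> R).

Lemma walk_weight_cat x p q :
  walk_weight w x (p ++ q) = walk_weight w x p + walk_weight w (last x p) q.
Proof. by rewrite /walk_weight pairmap_cat big_cat. Qed.

Lemma walk_weight1 x y : walk_weight w x [:: y] = w x y.
Proof. by rewrite /walk_weight /= big_seq1. Qed.

Lemma walk_weight_rcons x p y :
  walk_weight w x (rcons p y) = walk_weight w x p + w (last x p) y.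
Proof. by rewrite -cats1 walk_weight_cat walk_weight1. Qed.

Lemma walk_weight_nil x : walk_weight w x [::] = 0.
Proof. by rewrite /walk_weight big_nil. Qed.

Hypothesis w_ge0 : forall x y, 0 <= w x y.

Lemma walk_weight_ge0 x p : 0 <= walk_weight w x p.
Proof.
elim: p x => [|y p IH] x; first by rewrite walk_weight_nil.
by rewrite -cat1s walk_weight_cat walk_weight1 addr_ge0.
Qed.

(** Since [V] is finite, strict comparison of real ranks is well founded. *)
Lemma rank_ind (rank : V -> R) (Q : V -> Prop) :
  (forall t, (forall u, rank u < rank t -> Q u) -> Q t) -> forall t, Q t.
Proof.
move=> step t.
elim: {t}_.+1 {-2}t (ltnSn #|[set u | rank u < rank t]|) => // n IH t cardt.
apply: step => u ut; apply: IH; rewrite -ltnS; apply: leq_trans cardt.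
rewrite ltnS; apply: proper_card; apply/properP; split.
  by apply/subsetP => x; rewrite !inE => xu; apply: lt_trans xu ut.
by exists u; rewrite inE // ltxx.
Qed.

(** The label of [t] is an infimum over walks. The parent minimises [f q + w q t] over the
    neighbours [q] of [t]; every walk to [t] ends with such an edge, so no minimal walk is
    needed. *)
Lemma shortest_path_labels (e : rel V) (s : V) : (forall t, connect e s t) ->
  exists (f : V -> R) (par : V -> V),
    [/\ f s = 0,
        forall t, t != s -> e (par t) t /\ f (par t) + w (par t) t <= f t &
        forall p, path e s p -> f (last s p) <= walk_weight w s p].
Proof.
move=> conn.
pose S t : set R := [set walk_weight w s p | p in
  [set p : seq V | path e s p /\ last s p = t]]%classic.
have lbS t : has_lbound (S t).
  by exists 0 => _ [p _ <-]; apply: walk_weight_ge0.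
have nS t : (S t !=set0)%classic.
  have /connectP[p ep ->] := conn t; exists (walk_weight w s p); by exists p.
pose f t := inf (S t).
have fle p : path e s p -> f (last s p) <= walk_weight w s p.
  by move=> ep; apply: ge_inf => //; exists p.
have fs : f s = 0.
  apply/eqP; rewrite eq_le; apply/andP; split.
    by have := fle [::] isT; rewrite walk_weight_nil.
  by apply: lb_le_inf => // _ [p _ <-]; apply: walk_weight_ge0.
have step t : t != s -> exists q, e q t /\ f q + w q t <= f t.
  move=> ts.
  have [q0 eq0] : exists q, e q t.
    have /connectP[p] := conn t.
    case/lastP: p => [_ /= E|p y]; first by rewrite E eqxx in ts.
    by rewrite rcons_path last_rcons => /andP[_ ey] ->; exists (last s p).
  case: (@Order.TotalTheory.arg_minP _ _ _ q0 (fun q => e q t)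
    (fun q => f q + w q t) eq0) => q eqt qmin.
  exists q; split=> //; apply: lb_le_inf => // _ [p [ep lastp] <-].
  case/lastP: p ep lastp => [_ /= E|p y]; first by rewrite E eqxx in ts.
  rewrite rcons_path last_rcons => /andP[ep ey] yt; rewrite yt in ey *.
  rewrite walk_weight_rcons; apply: le_trans (qmin _ ey) _.
  by rewrite lerD2r; apply: fle.
have step' t : exists q, t != s -> e q t /\ f q + w q t <= f t.
  by have [->|/step[q hq]] := eqVneq t s; [exists s | exists q].
by have [par parP] := boolp.choice step'; exists f, par.
Qed.

Hypothesis w_sym : forall x y, w x y = w y x.

(** With [q] a parent map this is a rooted tree; with [q] the net assignment it is the set of added
    edges. *)
Definition star_graph (A : {set V}) (q : V -> V) : rel V :=
  [rel x y | (x \in A) && (q x == y) || (y \in A) && (q y == x)].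

Lemma star_graph_sym A q : symmetric (star_graph A q).
Proof. by move=> x y; rewrite /star_graph /= orbC. Qed.

Lemma sum_star_arcs (A : {set V}) q :
  \sum_x \sum_y ((x \in A) && (q x == y))%:R * w x y = \sum_(x in A) w x (q x).
Proof.
rewrite [RHS]big_mkcond; apply: eq_bigr => x _; case: ifP => xA /=; last first.
  by rewrite big1 // => y _; rewrite mul0r.
rewrite (bigD1 (q x)) //= eqxx mul1r big1 ?addr0 // => y.
by rewrite eq_sym => /negbTE ->; rewrite mul0r.
Qed.

Lemma sum_star_arcs_rev (A : {set V}) q :
  \sum_x \sum_y ((y \in A) && (q y == x))%:R * w x y = \sum_(x in A) w x (q x).
Proof.
rewrite exchange_big -sum_star_arcs; apply: eq_bigr => x _.
by apply: eq_bigr => y _; rewrite w_sym.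
Qed.

Lemma graph_weightE e :
  graph_weight w e = (\sum_x \sum_y (e x y)%:R * w x y) / 2.
Proof.
congr (_ / _); apply: eq_bigr => x _; rewrite big_mkcond; apply: eq_bigr => y _.
by case: (e x y); rewrite ?mul1r ?mul0r.
Qed.

Lemma graph_weight_le (e e1 e2 : rel V) :
  (forall x y, e x y -> e1 x y || e2 x y) ->
  graph_weight w e <= graph_weight w e1 + graph_weight w e2.
Proof.
move=> sub; rewrite !graph_weightE -mulrDl ler_pM2r ?invr_gt0 //.
rewrite -big_split; apply: ler_sum => x _; rewrite -big_split.
apply: ler_sum => y _; rewrite /= -mulrDl ler_wpM2r // -natrD ler_nat.
by have := sub x y; case: (e x y) => //= /(_ isT); case: (e1 x y) (e2 x y) => [] [].
Qed.

Lemma star_graph_weight (A : {set V}) q :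
  graph_weight w (star_graph A q) <= \sum_(x in A) w x (q x).
Proof.
rewrite graph_weightE ler_pdivrMr // mulr_natr mulr2n -{1}sum_star_arcs.
rewrite -sum_star_arcs_rev -big_split; apply: ler_sum => x _; rewrite -big_split.
apply: ler_sum => y _; rewrite /= -mulrDl ler_wpM2r // -natrD ler_nat /star_graph /=.
by case: (_ && _) (_ && _) => [] [].
Qed.

Section ParentTree.
Variables (s : V) (f : V -> R) (par : V -> V).
Hypothesis f_par : forall t, t != s -> f (par t) < f t.

Lemma parents_weight_le (e : rel V) : symmetric e ->
  (forall t, t != s -> e (par t) t) ->
  \sum_(t in ~: [set s]) w t (par t) <= graph_weight w e.
Proof.
move=> sym_e hpar; rewrite graph_weightE ler_pdivlMr // mulr_natr mulr2n.
rewrite -{1}sum_star_arcs -sum_star_arcs_rev -big_split.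
apply: ler_sum => x _; rewrite -big_split /=; apply: ler_sum => y _.
rewrite /= -mulrDl ler_wpM2r // -natrD ler_nat !inE.
have [/andP[xs /eqP exy]|_] := boolP ((x != s) && (par x == y));
  have [/andP[ys /eqP eyx]|_] := boolP ((y != s) && (par y == x)) => //.
(* Two vertices cannot be parents of each other, so no edge is charged twice. *)
- have lt_yx := f_par xs; have lt_xy := f_par ys; rewrite exy in lt_yx; rewrite eyx in lt_xy.
  by have := lt_trans lt_xy lt_yx; rewrite ltxx.
- by rewrite sym_e -exy hpar.
- by rewrite -eyx hpar.
Qed.

Let T := star_graph (~: [set s]) par.

Lemma parent_edge t : t != s -> T (par t) t.
Proof. by move=> ts; rewrite /T /star_graph /= !inE ts eqxx orbT. Qed.

Lemma parent_walk t : (forall t, t != s -> f (par t) + w (par t) t <= f t) ->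
  exists p, [/\ path T s p, last s p = t & walk_weight w s p <= f t - f s].
Proof.
move=> hf; elim/(@rank_ind f): t => t IH.
have [->|ts] := eqVneq t s.
  by exists [::]; split=> //; rewrite walk_weight_nil subrr.
have [p [pT lp wp]] := IH _ (f_par ts).
exists (rcons p t); split; rewrite ?last_rcons //.
  by rewrite rcons_path pT lp parent_edge.
by rewrite walk_weight_rcons lp; have := hf t ts; lra.
Qed.

Lemma parent_connect t : connect T s t.
Proof.
elim/(@rank_ind f): t => t IH; have [->//|ts] := eqVneq t s.
exact: connect_trans (IH _ (f_par ts)) (connect1 (parent_edge ts)).
Qed.

(** On a cycle, both neighbours of a vertex of maximal label would have to be its parent, and hence
    equal. *)
Lemma parent_spanning_tree : spanning_tree T.
Proof.
have symT : symmetric T := star_graph_sym _ _.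
split.
- split=> // x; rewrite /T /star_graph /= !inE orbb.
  by apply/negbTE/negP => /andP[/(par_neq f_par)/negbTE ->].
- move=> x y; apply: connect_trans (parent_connect y).
  by rewrite (sym_connect_sym symT) parent_connect.
- move=> c uc cT; rewrite leqNgt; apply/negP => c3.
  have [x0 x0c] : exists x0, x0 \in c by case: c c3 {uc cT} => // x c _; exists x; rewrite mem_head.
  case: (@Order.TotalTheory.arg_maxP _ _ _ x0 (fun x => x \in c) f x0c) => x xc xmax.
  have [i c' ec] := rot_to xc.
  have up y : y \in c -> T x y -> y = par x.
    move=> yc; rewrite /T /star_graph /= !inE => /orP[/andP[_ /eqP //]|/andP[ys /eqP yx]].
    have le_yx : f y <= f x := xmax y yc.
    by have := lt_le_trans (f_par ys) le_yx; rewrite yx ltxx.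
  move: c3 uc cT; rewrite -(size_rot i) -(rot_uniq i) -(rot_cycle i) ec.
  have memc y : y \in c' -> y \in c by move=> yc'; rewrite -(mem_rot i) ec inE yc' orbT.
  case: c' ec memc => [|y [|z c'']] //= _ memc _ /and3P[_ yc _].
  rewrite rcons_path => /andP[Txy /andP[_ /andP[_ Tzx]]].
  have ey := up y (memc y (mem_head _ _)) Txy.
  have lin : last z c'' \in z :: c'' by apply: mem_last.
  have ez := up (last z c'') (memc _ (mem_behead (s := [:: y, z & c'']) lin)) _.
  rewrite symT in ez; have {}ez := ez Tzx.
  by move: yc; rewrite ey -ez lin.
Qed.

End ParentTree.

Lemma ex_min_spanning_tree (s : V) : exists m, min_spanning_tree w m.
Proof.
(* Relations are encoded as finite functions to get a finite type to minimise over; the star at [s]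
   shows that it contains a spanning tree. *)
pose g (F : {ffun V * V -> bool}) : rel V := fun x y => F (x, y).
have gK (e : rel V) : g [ffun z => e z.1 z.2] = e.
  by apply/funext => x; apply/funext => y; rewrite /g ffunE.
pose F0 := [ffun z => star_graph (~: [set s]) (fun=> s) z.1 z.2].
have h0 : `[< spanning_tree (g F0) >].
  apply/asboolP; rewrite gK.
  apply: (@parent_spanning_tree s (fun t => if t == s then 0 else 1)) => t /negbTE ->.
  by rewrite eqxx.
case: (@Order.TotalTheory.arg_minP _ _ _ F0 (fun F => `[< spanning_tree (g F) >])
  (fun F => graph_weight w (g F)) h0) => F /asboolP tF Fmin.
exists (g F); split=> // e' te'.
by rewrite -(gK e'); apply: Fmin; apply/asboolP; rewrite gK.
Qed.

End Walks.

(** * Assembling the shallow-light tree *)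

Section EuclideanShallowLightTree.
Variables (R : realType) (d : nat) (V : finType) (pt : V -> 'rV[R]_d).
Hypothesis pt_inj : injective pt.
Variables (s : V) (eps : R).
Hypotheses (eps_gt0 : 0 < eps) (eps_small : eps <= 1 / 1200).

Let w x y := nrm (pt x - pt y).
Let D v := w v s.

Let w_ge0 x y : 0 <= w x y. Proof. exact: nrm_ge0. Qed.
Let w_sym x y : w x y = w y x. Proof. exact: nrmB. Qed.
Let w_tri y x z : w x z <= w x y + w y z. Proof. exact: nrm_triangle. Qed.
Let w_gt0 x y : x != y -> 0 < w x y.
Proof.
move=> xy; rewrite lt_def w_ge0 andbT; apply: contraNneq xy => /nrm0P/eqP.
by rewrite subr_eq0 => /eqP/pt_inj ->.
Qed.
Let D_gt0 v : v != s -> 0 < D v. Proof. exact: w_gt0. Qed.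

Lemma rooted_net (par : V -> V) (rank : V -> R) :
  (forall v, v != s -> rank (par v) < rank v) ->
  exists (C B : {set V}) (h : V -> R) (q : V -> V),
    [/\ s \notin C, B \subset C,
        forall v, 0 <= h v <= 2 * (eps / 50 / 100) * D v &
        forall v, v != s -> v \notin C -> w v (par v) + h v <= h (par v)] /\
    [/\ forall b, b \in B -> q b = s,
        forall c, c \in C -> c \notin B ->
          [/\ q c \in B, D (q c) <= D c & w (q c) c <= 999 / 1000 * (eps * D c)],
        eps / 50 / 100 * \sum_(c in C) D c <= \sum_(v in ~: [set s]) w v (par v) &
        3 / 5 * \sum_(b in B) (eps * D b) <= \sum_(v in ~: [set s]) w v (par v)].
Proof.
move=> rank_par.
have D_ge0 v : 0 <= D v by apply: w_ge0.
have k0 : 0 < eps / 50 / 100 by move: eps_gt0; lra.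
have k2 : eps / 50 / 100 <= 1 / 2 by move: eps_small; lra.
have lipD v : v != s -> D v <= D (par v) + w v (par v).
  by move=> _; rewrite addrC; apply: w_tri.
have [C [h [sC hh hpar hC]]] := cluster_decomposition rank_par k0 k2 D_ge0 lipD.
have [B [BC sepB netB]] := greedy_net (fun v => 999 / 1000 * (eps * D v)) C w_sym.
have sB : s \notin B by apply: contra sC; apply: (subsetP BC).
have Bs b : b \in B -> b != s by apply: contraTneq => ->.
have [q hq] : exists q : V -> V, forall c, (c \in B -> q c = s) /\
    (c \in C -> c \notin B ->
      [/\ q c \in B, D (q c) <= D c & w (q c) c <= 999 / 1000 * (eps * D c)]).
  suff /boolp.choice[q hq] : forall c, exists b, (c \in B -> b = s) /\
    (c \in C -> c \notin B ->
      [/\ b \in B, D b <= D c & w b c <= 999 / 1000 * (eps * D c)]) by exists q.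
  move=> c; have [cB|cB] := boolP (c \in B); first by exists s; split.
  have [cC|cC] := boolP (c \in C); last by exists s; split.
  have [b bB [h1 h2]] := netB c cC cB; exists b; split=> // _ _; split=> //.
  move: h1; rewrite ler_pM2l; last by lra.
  by rewrite ler_pM2l.
exists C, B, h, q; split; split=> //.
- by move=> b bB; case: (hq b) => /(_ bB).
- by move=> c; case: (hq c).
- apply: (packing_bound rank_par sB) => [b bB|b b' bB b'B bb'|b bB].
  + by rewrite mulr_gt0 // D_gt0 // Bs.
  + split; last exact: ltW (sepB b b' bB b'B bb').
    have e1 : eps * (D b - D b') <= eps * w b b'.
      by apply: ler_wpM2l; [exact: ltW | have := w_tri b' b s; rewrite /D; lra].
    have e2 : eps * w b b' <= 1 / 1200 * w b b' by apply: ler_wpM2r.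
    rewrite mulrBr in e1.
    by rewrite /= -/(w b b'); lra.
  + have := D_gt0 (Bs b bB); rewrite -/(w b s) -/(D b) => Db.
    have e2 : eps * D b <= 1 / 1200 * D b by apply: ler_wpM2r.
    by rewrite /=; lra.
Qed.

Lemma net_walk (e : rel V) (par : V -> V) (rank : V -> R) (C B : {set V})
    (h : V -> R) (q : V -> V) (t : V) :
  (forall v, v != s -> rank (par v) < rank v) ->
  (forall v, v != s -> e (par v) v) -> (forall c, c \in C -> e (q c) c) ->
  B \subset C ->
  (forall v, 0 <= h v <= 2 * (eps / 50 / 100) * D v) ->
  (forall v, v != s -> v \notin C -> w v (par v) + h v <= h (par v)) ->
  (forall b, b \in B -> q b = s) ->
  (forall c, c \in C -> c \notin B ->
     [/\ q c \in B, D (q c) <= D c & w (q c) c <= 999 / 1000 * (eps * D c)]) ->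
  exists p, [/\ path e s p, last s p = t & walk_weight w s p <= (1 + eps) * D t].
Proof.
move=> rank_par epar eq BC hh hpar qB qC.
have D_ge0 v : 0 <= D v by apply: w_ge0.
(* The stretch of the net leaves eps D / 1000 for the detour inside a cluster. *)
have anchor c : c = s \/ c \in C -> exists p, [/\ path e s p, last s p = c &
    walk_weight w s p <= (1 + 999 / 1000 * eps) * D c].
  have split_le v : (1 + 999 / 1000 * eps) * D v = D v + 999 / 1000 * (eps * D v).
    by rewrite mulrDl mul1r mulrA.
  have extra v : 0 <= 999 / 1000 * (eps * D v).
    have := mulr_ge0 (ltW eps_gt0) (D_ge0 v); move: (eps * D v) => x; lra.
  have root b : b \in B -> path e s [:: b] /\ walk_weight w s [:: b] = D b.
    move=> bB; rewrite walk_weight1 w_sym /= andbT; split=> //.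
    by rewrite -(qB b bB) eq // (subsetP BC).
  move=> [->|cC].
    exists [::]; split=> //; rewrite walk_weight_nil split_le.
    exact: addr_ge0.
  have [cB|cB] := boolP (c \in B).
    have [pc wc] := root c cB; exists [:: c]; split=> //.
    by rewrite wc split_le lerDl.
  have [bB Dbc wbc] := qC c cC cB; have [pb wb] := root _ bB.
  exists [:: q c; c]; split=> //.
    by move: pb => /= /andP[-> _]; rewrite eq.
  rewrite -[[:: q c; c]]/([:: q c] ++ [:: c]) walk_weight_cat wb walk_weight1 split_le.
  exact: lerD.
(* Climb from [t] to the first cluster root or to [s]; the inequalities for [h] telescope along the
   way. *)
have chain : exists c p, [/\ c = s \/ c \in C, path e c p, last c p = t,
    walk_weight w c p + h t <= h c & D c <= D t + walk_weight w c p].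
  elim/(@rank_ind R V rank): t => t IH.
  have here : t = s \/ t \in C -> exists c p, [/\ c = s \/ c \in C, path e c p,
      last c p = t, walk_weight w c p + h t <= h c & D c <= D t + walk_weight w c p].
    by exists t, [::]; rewrite walk_weight_nil add0r addr0.
  have [ts|ts] := eqVneq t s; first by apply: here; left.
  have [tC|tC] := boolP (t \in C); first by apply: here; right.
  have [c [p [hc pp lp wp Dp]]] := IH _ (rank_par t ts).
  exists c, (rcons p t); split=> //; rewrite ?last_rcons //.
  - by rewrite rcons_path pp lp epar.
  - by rewrite walk_weight_rcons lp w_sym; have := hpar t ts tC; lra.
  - rewrite walk_weight_rcons lp w_sym.
    by have := w_tri t (par t) s; rewrite (w_sym _ t) -/(D t) -/(D _); lra.
have [c [p' [hc pp' lp' wp' Dp']]] := chain.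
have [p [pp lp wp]] := anchor c hc.
exists (p ++ p'); rewrite cat_path lp pp pp' last_cat lp lp' walk_weight_cat lp; split=> //.
have /andP[ht0 _] := hh t; have /andP[_ hc2] := hh c.
(* The detour [x] is paid twice, in [D c <= D t + x] and in the descent, and [2 * x] is at most
   [eps * D c / 1250], within the reserve [eps * D t / 1000] up to terms of higher order. *)
set x := walk_weight w c p' in wp' Dp' *.
have x0 : 0 <= x by apply: walk_weight_ge0.
have ex : eps * x <= 1 / 1200 * x by apply: ler_wpM2r.
have eD : eps * D c <= eps * D t + eps * x by rewrite -mulrDr ler_pM2l.
by lra.
Qed.

(** [T] is a shortest-path tree of the graph [H] formed by the minimum spanning tree and the added
    edges, so it keeps the root distances of [H] and weighs no more. *)
Lemma euclidean_slt : exists T, shallow_light_tree w (1 + eps) (5 / (3 * eps) + 5000) s T.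
Proof.
have [m mst] := ex_min_spanning_tree w s.
have [[[sym_m irr_m] conn_m acyc_m] min_m] := mst.
have [rank [par [_ hpar _]]] := shortest_path_labels w_ge0 (conn_m s).
have rank_par v : v != s -> rank (par v) < rank v.
  move=> vs; have [e_pv le] := hpar v vs; apply: lt_le_trans le.
  rewrite ltrDl w_gt0 //; apply: contraTneq e_pv => ->; by rewrite irr_m.
have [C [B [h [q [[sC BC hh hpar'] [qB qC wC wB]]]]]] := rooted_net rank_par.
pose H x y := star_graph (~: [set s]) par x y || star_graph C q x y.
have H_par v : v != s -> H (par v) v.
  by move=> vs; rewrite /H /star_graph /= !inE vs eqxx orbT.
have H_q c : c \in C -> H (q c) c.
  by move=> cC; rewrite /H /star_graph /= cC eqxx !orbT.
have symH : symmetric H.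
  by move=> x y; rewrite /H star_graph_sym (star_graph_sym C).
have qneq c : c \in C -> q c != c.
  move=> cC; have [cB|cB] := boolP (c \in B).
    by rewrite qB //; apply: contraNneq sC => ->.
  by have [qcB _ _] := qC c cC cB; apply: contraNneq cB => <-.
have irrH x : H x x = false.
  rewrite /H /star_graph /= !inE !orbb; apply/negbTE/negP => /orP[]/andP[].
    by move=> xs; rewrite (negbTE (par_neq rank_par xs)).
  by move=> xC; rewrite (negbTE (qneq x xC)).
have walkH t := net_walk t rank_par H_par H_q BC hh hpar' qB qC.
have connH t : connect H s t.
  by have [p [pp <- _]] := walkH t; apply/connectP; exists p.
have [f [par' [fs hpar'' fle]]] := shortest_path_labels w_ge0 connH.
have f_par v : v != s -> f (par' v) < f v.
  move=> vs; have [e_pv le] := hpar'' v vs; apply: lt_le_trans le.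
  rewrite ltrDl w_gt0 //; apply: contraTneq e_pv => ->; by rewrite irrH.
pose T := star_graph (~: [set s]) par'.
have TH x y : T x y -> H x y.
  rewrite /T /star_graph /= !inE => /orP[]/andP[vs /eqP <-].
    by rewrite symH; case: (hpar'' x vs).
  by case: (hpar'' y vs).
have beta0 : 0 <= 5 / (3 * eps).
  by apply: divr_ge0; [exact: ler0n | apply: mulr_ge0; [exact: ler0n | exact: ltW]].
exists T; split.
- by rewrite lerDl ltW.
- apply: le_trans (_ : 5000 <= _); first by rewrite (ler_nat _ 1 5000).
  by rewrite lerDr.
- exact: parent_spanning_tree f_par.
- move=> t; have [p [pp lp wp]] := parent_walk f_par t (fun t ts => (hpar'' t ts).2).
  apply: (@le_trans _ _ (walk_weight w s p)%:E).
    by apply: ereal_inf_lbound; exists p.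
  rewrite lee_fin; apply: le_trans wp _; rewrite fs subr0.
  have [p' [pp' lp' wp']] := walkH t.
  by rewrite -lp'; apply: le_trans (fle _ pp') _; rewrite lp' w_sym.
exists m => //.
have W_m := parents_weight_le w_ge0 w_sym rank_par sym_m (fun t ts => (hpar t ts).1).
have W_T := graph_weight_le w_ge0 TH.
have W1 := star_graph_weight w_ge0 w_sym (~: [set s]) par.
have W2 := star_graph_weight w_ge0 w_sym C q.
have WC : \sum_(c in C) w c (q c) <= \sum_(b in B) D b + 999 / 1000 * (eps * \sum_(c in C) D c).
  rewrite !mulr_sumr.
  have -> : \sum_(b in B) D b = \sum_(c in C) (if c \in B then D c else 0).
    rewrite -big_mkcondr; apply: eq_bigl => c.
    by case: (boolP (c \in B)) => [cB|]; rewrite ?andbF // (subsetP BC).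
  rewrite -big_split; apply: ler_sum => c cC /=; case: ifPn => cB.
    rewrite (qB c cB) lerDl.
    have := mulr_ge0 (ltW eps_gt0) (w_ge0 c s); rewrite -/(D c).
    by move: (eps * D c) => x; lra.
  by rewrite add0r w_sym; case: (qC c cC cB).
set W := \sum_(v in ~: [set s]) w v (par v) in W_m W1 wB wC.
apply: (@le_trans _ _ ((5 / (3 * eps) + 5000) * W)); last first.
  apply: ler_wpM2l; [exact: addr_ge0 beta0 (ler0n R 5000) | exact: W_m].
rewrite mulrDl -mulr_sumr in wB *.
have BW : \sum_(b in B) D b <= 5 / (3 * eps) * W.
  rewrite -(ler_pM2l eps_gt0).
  have -> : eps * (5 / (3 * eps) * W) = 5 / 3 * W by field; rewrite gt_eqF.
  by lra.
(* The tree costs [W] and the edges from other cluster roots to the net at most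
   [999 / 1000 * 5000 * W], in total [4996 * W]. *)
have W0 : 0 <= W by apply: sumr_ge0.
by lra.
Qed.

End EuclideanShallowLightTree.

Theorem theorem1p1 (R : realType) :
  exists eps0 K : R, [/\ 0 < eps0, 0 < K &
    forall (d : nat), (1 <= d)%N ->
    forall (S : {fset 'rV[R]_d}) (s : S) (eps : R), 0 < eps -> eps <= eps0 ->
    exists T : rel S,
      shallow_light_tree (fun x y : S => euclidean_dist (val x) (val y))
        (1 + eps) (5 / (3 * eps) + K) s T].
Proof.
exists (1 / 1200), 5000; split; [lra | by rewrite ltr0n |].
move=> d _ S s eps eps_gt0 eps_small.
have -> : (fun x y : S => euclidean_dist (val x) (val y)) =
    (fun x y : S => nrm (val x - val y)).
  by apply/funext => x; apply/funext => y; rewrite euclidean_distE.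
exact: (euclidean_slt val_inj s eps_gt0 eps_small).
Qed.
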